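(* Let $\Gamma\cup\{\phi\}\subseteq\mathcal{L}_{\triangle,\Box,\lozenge}$ be finite. Then $\Gamma\models_{\mathbf{K}\mathsf{biG}^{\mathsf{f}}}\phi$ if and only if $\Gamma\vdash_{\mathcal{H}\mathbf{K}\mathsf{biG}^{\mathsf{f}}}\phi$.
   Context: Gödel operations on $[0,1]$: $a\wedge_G b=\min(a,b)$, $a\vee_G b=\max(a,b)$, $a\to_G b=1$ if $a\le b$ and $=b$ otherwise; ${\sim}_G a=1$ if $a=0$ and $0$ otherwise; $\triangle_G a=1$ if $a=1$ and $0$ otherwise. The language $\mathcal{L}_{\triangle,\Box,\lozenge}$ is generated from a countable set $\mathtt{Prop}$ of variables by $\phi::=p\mid{\sim}\phi\mid\triangle\phi\mid(\phi\wedge\phi)\mid(\phi\vee\phi)\mid(\phi\to\phi)\mid\Box\phi\mid\lozenge\phi$; $\mathbf 1:=p\to p$, $\mathbf 0:={\sim}\mathbf 1$. A fuzzy frame is $\langle W,R\rangle$ with $W\neq\emptyset$, $R:W\times W\to[0,1]$ (crisp frames included). A model adds $e:\mathtt{Prop}\times W\to[0,1]$, extended pointwise by the Gödel operations for ${\sim},\triangle,\wedge,\vee,\to$, and $e(\Box\phi,w)=\inf_{w'\in W}(wRw'\to_G e(\phi,w'))$, $e(\lozenge\phi,w)=\sup_{w'\in W}(wRw'\wedge_G e(\phi,w'))$. $\Gamma\models_{\mathbf{K}\mathsf{biG}^{\mathsf{f}}}\chi$ means: for every model on a fuzzy frame and every state $w$, $\inf\{e(\psi,w):\psi\in\Gamma\}\le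 e(\chi,w)$. $\mathcal{H}\mathsf{G}\triangle$ has axiom schemas: $(\phi\to\chi)\to((\chi\to\psi)\to(\phi\to\psi))$; $\phi\to(\phi\vee\chi)$, $\chi\to(\phi\vee\chi)$, $(\phi\to\psi)\to((\chi\to\psi)\to((\phi\vee\chi)\to\psi))$; $(\phi\wedge\chi)\to\phi$, $(\phi\wedge\chi)\to\chi$, $(\phi\to\chi)\to((\phi\to\psi)\to(\phi\to(\chi\wedge\psi)))$; $(\phi\to(\chi\to\psi))\to((\phi\wedge\chi)\to\psi)$, $((\phi\wedge\chi)\to\psi)\to(\phi\to(\chi\to\psi))$; ${\sim}\phi\to(\phi\to\chi)$; $(\phi\to\chi)\vee(\chi\to\phi)$; $\triangle\phi\vee{\sim}\triangle\phi$; $\triangle(\phi\to\chi)\to(\triangle\phi\to\triangle\chi)$, $\triangle(\phi\vee\chi)\to(\triangle\phi\vee\triangle\chi)$; $\triangle\phi\to\phi$, $\triangle\phi\to\triangle\triangle\phi$; rules modus ponens and $\triangle$-necessitation (from $\vdash\phi$ infer $\vdash\triangle\phi$). $\mathcal{H}\mathbf{K}\mathsf{biG}^{\mathsf{f}}$ has: all substitution instances of theorems and rules of $\mathcal{H}\mathsf{G}\triangle$; axioms ${\sim}\lozenge\mathbf 0$; $\Box(\phi\to\chi)\to(\Box\phi\to\Box\chi)$; $\lozenge(\phi\vee\chi)\to(\lozenge\phi\vee\lozenge\chi)$; $\lozenge(\phi\to\chi)\to(\Box\phi\to\lozenge\chi)$; $(\lozenge\phi\to\Box\chi)\to\Box(\phi\to\chi)$;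 rules: from $\vdash\phi$ infer $\vdash\Box\phi$; from $\vdash\phi\to\chi$ infer $\vdash\lozenge\phi\to\lozenge\chi$. $\Gamma\vdash\chi$ means there is a finite sequence ending in $\chi$ of members of $\Gamma$, axiom instances, modus ponens consequences, and results of $\triangle$-necessitation, $\Box$-necessitation or the $\lozenge$-rule applied only to earlier members not depending on $\Gamma$.
   Formalization: The calculus has one extra axiom schema, (φ→0)→∼φ, beyond those listed for HG△; with only ∼φ→(φ→χ) and △φ∨∼△φ governing ∼, the valid formula ∼∼1 is not derivable, so the statement as listed fails for empty Γ. *)

(* Defs.v *)
From mathcomp Require Import all_boot all_order all_algebra.
From mathcomp Require Import classical_sets cardinality reals.

Set Implicit Arguments.
Unset Strict Implicit.
Unset Printing Implicit Defensive.

Import Order.TTheory GRing.Theory Num.Theory.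

Local Open Scope classical_set_scope.
Local Open Scope ring_scope.

Inductive fml : Type :=
| Var of nat
| Neg of fml
| Tri of fml
| And of fml & fml
| Or  of fml & fml
| Imp of fml & fml
| Box of fml
| Dia of fml.

Declare Scope fml_scope.
Delimit Scope fml_scope with F.
Bind Scope fml_scope with fml.

Notation "~~~ a" := (Neg a) (at level 35, right associativity) : fml_scope.
Notation "△ a" := (Tri a) (at level 35, right associativity) : fml_scope.
Notation "□ a" := (Box a) (at level 35, right associativity) : fml_scope.
Notation "◇ a" := (Dia a) (at level 35, right associativity) : fml_scope.
Notation "a ⊓ b" := (And a b) (at level 40, left associativity) : fml_scope.
Notation "a ⊔ b" := (Or a b) (at level 50, left associativity) : fml_scope.
Notation "a ⊃ b" := (Imp a b) (at level 60, right associativity) : fml_scope.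

Definition ftop : fml := (Var 0 ⊃ Var 0)%F.
Definition fbot : fml := (~~~ ftop)%F.

(* The language of the propositional calculus is the modality-free
   fragment. *)
Fixpoint modfree (a : fml) : bool :=
  match a with
  | Var _ => true
  | Neg b | Tri b => modfree b
  | And b c | Or b c | Imp b c => modfree b && modfree c
  | Box _ | Dia _ => false
  end.

Fixpoint subst (s : nat -> fml) (a : fml) : fml :=
  match a with
  | Var n => s n
  | Neg b => Neg (subst s b)
  | Tri b => Tri (subst s b)
  | And b c => And (subst s b) (subst s c)
  | Or b c => Or (subst s b) (subst s c)
  | Imp b c => Imp (subst s b) (subst s c)
  | Box b => Box (subst s b)
  | Dia b => Dia (subst s b)
  end.

Section Semantics.
Variable R : realType.
Implicit Types a b : R.

Definition gand a b : R := Num.min a b.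
Definition gor a b : R := Num.max a b.
Definition gimp a b : R := if a <= b then 1 else b.
Definition gneg a : R := if a == 0 then 1 else 0.
Definition gtri a : R := if a == 1 then 1 else 0.

Record fuzzy_frame := FuzzyFrame {
  world :> Type;
  world_inhabited : inhabited world;
  acc : world -> world -> R;
  acc_itv : forall w w', 0 <= acc w w' <= 1
}.

Record model := Model {
  frame :> fuzzy_frame;
  valuation : nat -> frame -> R;
  valuation_itv : forall n w, 0 <= valuation n w <= 1
}.

(* The sets under [inf] and [sup] are non-empty subsets of [0,1], so these
   are the actual infimum and supremum rather than the default value 0. *)
Fixpoint eval (M : model) (a : fml) (w : M) : R :=
  match a with
  | Var n => valuation n w
  | Neg b => gneg (eval b w)
  | Tri b => gtri (eval b w)
  | And b c => gand (eval b w) (eval c w)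
  | Or b c => gor (eval b w) (eval c w)
  | Imp b c => gimp (eval b w) (eval c w)
  | Box b => inf (range (fun w' : M => gimp (acc w w') (eval b w')))
  | Dia b => sup (range (fun w' : M => gand (acc w w') (eval b w')))
  end.

(* The infimum is taken in [0,1], where the empty set has infimum 1; on reals
   [inf set0] is 0.  Adjoining 1 gives the right value for an empty [G] and
   changes nothing otherwise. *)
Definition entails (G : set fml) (c : fml) : Prop :=
  forall (M : model) (w : M),
    inf (1 |` [set eval a w | a in G]) <= eval c w.

End Semantics.

(* [Neg] is primitive, and [ax_neg] bounds it only from above: with [ax_neg]
   as the sole schema for [Neg], even the valid [~~~ ~~~ ftop] is not
   derivable (interpret [Neg a] as false unless [a] starts with [Tri] or
   [Dia]).  [ax_negI] is the missing converse; the two together say that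
   [Neg a] is equivalent to [a ⊃ fbot], as in Gödel logic. *)
Inductive ax_GTri : fml -> Prop :=
| ax_trans a b c : ax_GTri ((a ⊃ b) ⊃ ((b ⊃ c) ⊃ (a ⊃ c)))
| ax_orl a b : ax_GTri (a ⊃ (a ⊔ b))
| ax_orr a b : ax_GTri (b ⊃ (a ⊔ b))
| ax_orE a b c : ax_GTri ((a ⊃ c) ⊃ ((b ⊃ c) ⊃ ((a ⊔ b) ⊃ c)))
| ax_andl a b : ax_GTri ((a ⊓ b) ⊃ a)
| ax_andr a b : ax_GTri ((a ⊓ b) ⊃ b)
| ax_andI a b c : ax_GTri ((a ⊃ b) ⊃ ((a ⊃ c) ⊃ (a ⊃ (b ⊓ c))))
| ax_uncurry a b c : ax_GTri ((a ⊃ (b ⊃ c)) ⊃ ((a ⊓ b) ⊃ c))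
| ax_curry a b c : ax_GTri (((a ⊓ b) ⊃ c) ⊃ (a ⊃ (b ⊃ c)))
| ax_neg a b : ax_GTri (~~~ a ⊃ (a ⊃ b))
| ax_negI a : ax_GTri ((a ⊃ fbot) ⊃ ~~~ a)
| ax_lin a b : ax_GTri ((a ⊃ b) ⊔ (b ⊃ a))
| ax_tri_em a : ax_GTri (△ a ⊔ ~~~ (△ a))
| ax_tri_imp a b : ax_GTri (△ (a ⊃ b) ⊃ (△ a ⊃ △ b))
| ax_tri_or a b : ax_GTri (△ (a ⊔ b) ⊃ (△ a ⊔ △ b))
| ax_tri_elim a : ax_GTri (△ a ⊃ a)
| ax_tri_tri a : ax_GTri (△ a ⊃ △ (△ a)).

Inductive thm_GTri : fml -> Prop :=
| thm_ax a : modfree a -> ax_GTri a -> thm_GTri a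
| thm_mp a b : thm_GTri (a ⊃ b) -> thm_GTri a -> thm_GTri b
| thm_nec a : thm_GTri a -> thm_GTri (△ a).

Inductive ax_KbiG : fml -> Prop :=
| ax_prop s a : thm_GTri a -> ax_KbiG (subst s a)
| ax_dia_bot : ax_KbiG (~~~ (◇ fbot))
| ax_box_imp a b : ax_KbiG (□ (a ⊃ b) ⊃ (□ a ⊃ □ b))
| ax_dia_or a b : ax_KbiG (◇ (a ⊔ b) ⊃ (◇ a ⊔ ◇ b))
| ax_dia_imp a b : ax_KbiG (◇ (a ⊃ b) ⊃ (□ a ⊃ ◇ b))
| ax_FS2 a b : ax_KbiG ((◇ a ⊃ □ b) ⊃ □ (a ⊃ b)).

(* The last three rules apply only to formulas whose derivation does not
   depend on [G], hence the empty set of assumptions in their premises. *)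
Inductive derives (G : set fml) : fml -> Prop :=
| d_hyp a : G a -> derives G a
| d_ax a : ax_KbiG a -> derives G a
| d_mp a b : derives G (a ⊃ b) -> derives G a -> derives G b
| d_tri_nec a : derives set0 a -> derives G (△ a)
| d_box_nec a : derives set0 a -> derives G (□ a)
| d_dia_mon a b : derives set0 (a ⊃ b) -> derives G (◇ a ⊃ ◇ b).

(* Main.v *)
(** For completeness, suppose that [p ⊃ c] is not derivable, [p] being the
    conjunction of [G].  Worlds of the canonical model are pairs of a prime
    theory [T] closed under [△] and a valuation [v] in [0,1] which, on the
    finite set [F] of subformulas, realises the linear preorder [T (a ⊃ b)].
    Degrees of accessibility are the largest ones compatible with [□] and [◇]
    on [F].  The infimum defining [□ f] need not be attained: for a threshold
    just above the value of [□ f], one finds a prime theory [T'] in which all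
    [a] with [□ a] above [□ f] in [T] lie strictly above [f].  By the two
    Fischer Servi axioms, the lower bounds (from [□]) and upper bounds (from
    [◇]) that the threshold puts on the values in [F] are then compatible with
    the order of [T'], so [T'] has a valuation between them; [◇] is dual. *)
Require Import Defs.
From HB Require Import structures.
From mathcomp Require Import all_boot all_order all_algebra.
From mathcomp Require Import boolp classical_sets cardinality reals lra.

Set Implicit Arguments.
Unset Strict Implicit.
Unset Printing Implicit Defensive.

Import Order.TTheory GRing.Theory Num.Theory.

Local Open Scope classical_set_scope.
Local Open Scope ring_scope.

(** * Theories and derived rules of the calculus *)

HB.instance Definition _ := gen_eqMixin fml.

Local Notation "|- a" := (derives set0 a) (at level 70).

Lemma derives_ax_GTri G a : ax_GTri a -> derives G a.
Proof.
(* Instances arise by substitution from the schemas written at variables 1, 2, 3. Variable 0 is kept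
   fixed because [ftop] and [fbot], hence [ax_negI], are built from it. *)
pose s a b c n := match n with 0%N => Var 0 | 1%N => a | 2%N => b | _ => c end.
pose i a b c x ax (m : modfree x) : derives G (subst (s a b c) x) :=
  d_ax G (ax_prop (s a b c) (thm_ax m ax)).
case.
- move=> a1 b c; exact (i a1 b c _ (ax_trans (Var 1) (Var 2) (Var 3)) isT).
- move=> a1 b; exact (i a1 b b _ (ax_orl (Var 1) (Var 2)) isT).
- move=> a1 b; exact (i a1 b b _ (ax_orr (Var 1) (Var 2)) isT).
- move=> a1 b c; exact (i a1 b c _ (ax_orE (Var 1) (Var 2) (Var 3)) isT).
- move=> a1 b; exact (i a1 b b _ (ax_andl (Var 1) (Var 2)) isT).
- move=> a1 b; exact (i a1 b b _ (ax_andr (Var 1) (Var 2)) isT).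
- move=> a1 b c; exact (i a1 b c _ (ax_andI (Var 1) (Var 2) (Var 3)) isT).
- move=> a1 b c; exact (i a1 b c _ (ax_uncurry (Var 1) (Var 2) (Var 3)) isT).
- move=> a1 b c; exact (i a1 b c _ (ax_curry (Var 1) (Var 2) (Var 3)) isT).
- move=> a1 b; exact (i a1 b b _ (ax_neg (Var 1) (Var 2)) isT).
- move=> a1; exact (i a1 a1 a1 _ (ax_negI (Var 1)) isT).
- move=> a1 b; exact (i a1 b b _ (ax_lin (Var 1) (Var 2)) isT).
- move=> a1; exact (i a1 a1 a1 _ (ax_tri_em (Var 1)) isT).
- move=> a1 b; exact (i a1 b b _ (ax_tri_imp (Var 1) (Var 2)) isT).
- move=> a1 b; exact (i a1 b b _ (ax_tri_or (Var 1) (Var 2)) isT).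
- move=> a1; exact (i a1 a1 a1 _ (ax_tri_elim (Var 1)) isT).
- move=> a1; exact (i a1 a1 a1 _ (ax_tri_tri (Var 1)) isT).
Qed.

(** The three restricted rules have premises derived from the empty set, so they apply verbatim over
    [G]. *)
Lemma derives_weaken G a : |- a -> derives G a.
Proof.
move: {-1}(set0 : set fml) (erefl (set0 : set fml)) => H eH d.
elim: d G eH => {H a} [H a Ha|H a ax|H a b _ IH1 _ IH2|H a d _|H a d _|H a b d _] G eH.
- by move: Ha; rewrite -eH.
- exact: d_ax.
- exact: d_mp (IH1 G eH) (IH2 G eH).
- exact: d_tri_nec.
- exact: d_box_nec.
- exact: d_dia_mon.
Qed.

(** Closure under the necessitation rules is left out, so that [derives G] and the consequences of a
    formula inside a theory are theories too, and every derived rule below can be used in them. *)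
Record theory (T : fml -> Prop) : Prop := Theory {
  theory_thm : forall a, |- a -> T a;
  theory_mp : forall a b, T (a ⊃ b)%F -> T a -> T b
}.

Lemma theory_derives G : theory (derives G).
Proof. by split; [exact: derives_weaken | exact: d_mp]. Qed.

Section Theory.
Variables (T : fml -> Prop) (thT : theory T).
Implicit Types a b c x : fml.

Let ax a : ax_GTri a -> T a.
Proof. by move=> ?; apply: theory_thm => //; exact: derives_ax_GTri. Qed.
Let mp a b : T (a ⊃ b)%F -> T a -> T b.
Proof. exact: theory_mp. Qed.

Lemma imp_trans a b c : T (a ⊃ b)%F -> T (b ⊃ c)%F -> T (a ⊃ c)%F.
Proof. by move=> ab; apply: mp; apply: mp ab; apply/ax/ax_trans. Qed.

Lemma imp_and a b c : T (a ⊃ b)%F -> T (a ⊃ c)%F -> T (a ⊃ (b ⊓ c))%F.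
Proof. by move=> ab; apply: mp; apply: mp ab; apply/ax/ax_andI. Qed.

Lemma and_impl a b : T (a ⊓ b ⊃ a)%F. Proof. exact/ax/ax_andl. Qed.
Lemma and_impr a b : T (a ⊓ b ⊃ b)%F. Proof. exact/ax/ax_andr. Qed.

Lemma imp_weak a b : T a -> T (b ⊃ a)%F.
Proof. by apply: mp; apply: (mp (ax (ax_curry _ _ _))); exact: and_impl. Qed.

Lemma imp_curry a b c : T (a ⊓ b ⊃ c)%F -> T (a ⊃ (b ⊃ c))%F.
Proof. exact: (mp (ax (ax_curry _ _ _))). Qed.

Lemma imp_uncurry a b c : T (a ⊃ (b ⊃ c))%F -> T (a ⊓ b ⊃ c)%F.
Proof. exact: (mp (ax (ax_uncurry _ _ _))). Qed.

Lemma imp_perm a b c : T (a ⊃ (b ⊃ c))%F -> T (b ⊃ (a ⊃ c))%F.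
Proof.
move=> /imp_uncurry h; apply: imp_curry; apply: imp_trans h.
by apply: imp_and; [exact: and_impr | exact: and_impl].
Qed.

Lemma imp_refl a : T (a ⊃ a)%F.
Proof.
(* Here [h] is a ⊃ (x ⊃ a) with x the axiom a ⊓ a ⊃ a; permuting the premises allows x to be
   discharged. *)
have h := imp_curry (and_impl a (a ⊓ a ⊃ a)%F).
exact: mp (imp_perm h) (and_impl _ _).
Qed.

(* The deduction theorem: [T (x ⊃ a)] may be proved by reasoning inside the
   theory of the consequences of [x]. *)
Lemma theory_imp x : theory (fun a => T (x ⊃ a)%F).
Proof.
split=> [a da|a b xab xa]; first by apply: imp_weak; exact: theory_thm.
exact: imp_trans (imp_and (imp_refl x) xa) (imp_uncurry xab).
Qed.

Lemma and_intro a b : T a -> T b -> T (a ⊓ b)%F.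
Proof.
move=> Ta Tb; apply: (mp _ (imp_refl a)).
by apply: imp_and; apply: imp_weak.
Qed.

Lemma or_impl a b : T (a ⊃ a ⊔ b)%F. Proof. exact/ax/ax_orl. Qed.
Lemma or_impr a b : T (b ⊃ a ⊔ b)%F. Proof. exact/ax/ax_orr. Qed.

Lemma or_imp a b c : T (a ⊃ c)%F -> T (b ⊃ c)%F -> T (a ⊔ b ⊃ c)%F.
Proof. by move=> ac; apply: mp; apply: mp ac; apply/ax/ax_orE. Qed.

Lemma top_intro : T ftop. Proof. exact: imp_refl. Qed.

Lemma bot_imp a : T (fbot ⊃ a)%F.
Proof.
have h : T (fbot ⊃ (ftop ⊃ a))%F by apply/ax/ax_neg.
exact: mp (imp_perm h) top_intro.
Qed.

Lemma neg_imp_bot a : T (~~~ a ⊃ (a ⊃ fbot))%F. Proof. exact/ax/ax_neg. Qed.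
Lemma imp_bot_neg a : T ((a ⊃ fbot) ⊃ ~~~ a)%F. Proof. exact/ax/ax_negI. Qed.

Lemma box_imp a b : T (□ (a ⊃ b))%F -> T (□ a)%F -> T (□ b)%F.
Proof. by move=> h; apply: mp; apply: mp h; apply/(theory_thm thT)/d_ax/ax_box_imp. Qed.

Lemma box_thm a : |- a -> T (□ a)%F.
Proof. by move=> h; apply/(theory_thm thT)/d_box_nec. Qed.

Lemma dia_imp a b : T (◇ (a ⊃ b))%F -> T (□ a)%F -> T (◇ b)%F.
Proof. by move=> h; apply: mp; apply: mp h; apply/(theory_thm thT)/d_ax/ax_dia_imp. Qed.

Lemma dia_mon a b : |- (a ⊃ b)%F -> T (◇ a)%F -> T (◇ b)%F.
Proof. by move=> h; apply/mp/(theory_thm thT)/d_dia_mon. Qed.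

Lemma dia_or a b : T (◇ (a ⊔ b) ⊃ ◇ a ⊔ ◇ b)%F.
Proof. exact/(theory_thm thT)/d_ax/ax_dia_or. Qed.

Lemma dia_bot_imp a : T (◇ fbot ⊃ a)%F.
Proof.
have h : T (~~~ ◇ fbot)%F by apply/(theory_thm thT)/d_ax/ax_dia_bot.
exact: mp (ax (ax_neg _ _)) h.
Qed.

Lemma dia_box_imp a b : T (◇ a ⊃ □ b)%F -> T (□ (a ⊃ b))%F.
Proof. by apply/mp/(theory_thm thT)/d_ax/ax_FS2. Qed.

End Theory.

Lemma theory_nil : theory (derives set0). Proof. exact: theory_derives. Qed.

Section ModalTheory.
Variables (T : fml -> Prop) (thT : theory T).

Lemma box_mon a b : |- (a ⊃ b)%F -> T (□ a)%F -> T (□ b)%F.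
Proof. by move=> h; apply: box_imp => //; exact: box_thm. Qed.

Lemma box_and a b : T (□ a)%F -> T (□ b)%F -> T (□ (a ⊓ b))%F.
Proof.
move=> Ta; apply: box_imp => //; apply: box_mon Ta.
exact/(imp_curry theory_nil)/(imp_refl theory_nil).
Qed.

(** From □b follows □(a ⊃ c), and a ⊃ ((a ⊃ c) ⊃ c) turns ◇a into ◇((a ⊃ c) ⊃ c); [ax_dia_imp]
    combines the two. *)
Lemma dia_and_box a b c :
  |- (a ⊓ b ⊃ c)%F -> T (◇ a)%F -> T (□ b)%F -> T (◇ c)%F.
Proof.
move=> h Ta Tb; have Tab : T (□ (a ⊃ c))%F.
  by apply: box_mon Tb; apply/(imp_perm theory_nil)/(imp_curry theory_nil).
apply: dia_imp Tab => //; apply: dia_mon Ta => //.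
exact/(imp_perm theory_nil)/(imp_refl theory_nil).
Qed.

End ModalTheory.

(** * Prime theories and their existence *)

(** Membership in [T] is meant as having value 1, hence the closure under △. Primeness and
    prelinearity make T (a ⊃ b) a total preorder. *)
Record prime_theory (T : fml -> Prop) : Prop := PrimeTheory {
  prime_theory_theory :> theory T;
  prime_or : forall a b, T (a ⊔ b)%F -> T a \/ T b;
  prime_tri : forall a, T a -> T (△ a)%F;
  prime_bot : ~ T fbot
}.

Section Prime.
Variables (T : fml -> Prop) (pT : prime_theory T).
Let thT : theory T := pT.

Lemma prime_total a b : T (a ⊃ b)%F \/ T (b ⊃ a)%F.
Proof. by apply: prime_or => //; apply/(theory_thm thT)/derives_ax_GTri/ax_lin. Qed.

Lemma prime_not_imp a b : ~ T (a ⊃ b)%F -> T (b ⊃ a)%F.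
Proof. by case: (prime_total a b). Qed.

(** This is the second clause of the Gödel implication. By totality, a ⊃ b lies below a, and then
    detaching under the assumption a ⊃ b gives b, or above a, and then a ⊃ (a ⊃ b) contracts to a ⊃
    b. *)
Lemma prime_imp_imp a b : ~ T (a ⊃ b)%F -> T ((a ⊃ b) ⊃ b)%F.
Proof.
move=> nab; have thab := theory_imp thT (a ⊃ b)%F.
case: (prime_total (a ⊃ b)%F a) => h.
  exact: (theory_mp thab (imp_refl thT _) h).
have tha := theory_imp thT a.
by case: nab; exact: (theory_mp tha h (imp_refl thT a)).
Qed.

Lemma prime_top_imp a : T (ftop ⊃ a)%F <-> T a.
Proof.
split; last exact: imp_weak.
by move=> h; exact: theory_mp h (top_intro thT).
Qed.

Lemma prime_tri_bot a : ~ T a -> T (△ a ⊃ fbot)%F.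
Proof.
move=> na; have: T (△ a ⊔ ~~~ △ a)%F.
  by apply/(theory_thm thT)/derives_ax_GTri/ax_tri_em.
move=> /(prime_or pT)[h|h]; last exact: theory_mp (neg_imp_bot thT _) h.
case: na; apply: theory_mp h => //.
by apply/(theory_thm thT)/derives_ax_GTri/ax_tri_elim.
Qed.

Lemma prime_imp_or a b c :
  T (a ⊃ b ⊔ c)%F -> T (a ⊃ b)%F \/ T (a ⊃ c)%F.
Proof.
move=> h; case: (prime_total b c) => bc; [right|left]; apply: imp_trans h _ => //.
  by apply: or_imp => //; exact: imp_refl.
by apply: or_imp => //; exact: imp_refl.
Qed.

End Prime.

(** Zorn's lemma on △-closed theories avoiding [D]. If a maximal one omits both a and b, it contains
    △a ⊃ x and △b ⊃ y with x, y in [D], hence △a ⊔ △b ⊃ z for a common upper bound z in [D]; by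
    [ax_tri_or] it then omits a ⊔ b. Consistency comes from [d0]. *)
Lemma prime_extension (D : fml -> Prop) (d0 : fml) :
  D d0 ->
  (forall x y, D x -> D y ->
     exists z, [/\ D z, |- (x ⊃ z)%F & |- (y ⊃ z)%F]) ->
  (forall x, D x -> ~ |- x) ->
  exists T, prime_theory T /\ forall x, D x -> ~ T x.
Proof.
move=> Dd0 Ddir Dthm.
pose tri_closed (T : set fml) := forall a, T a -> T (△ a)%F.
pose good (T : set fml) :=
  [/\ theory T, tri_closed T & forall x, D x -> ~ T x].
have good_nil : good (derives set0).
  by split=> [|a|//]; [exact: theory_nil | exact: d_tri_nec].
have [F FP Ftot|T [T0 maxT]] := @Zorn_bigcup fml (fun X => X = set0 \/ good X).
  have [[X FX gX]|nX] := pselect (exists2 X, F X & good X); last first.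
    left; rewrite -subset0 => a [X FX Xa].
    by case: (FP X FX) => [X0|gX]; [rewrite X0 in Xa | case: nX; exists X].
  right; split=> [|a [Y FY Ya]|x Dx [Y FY Yx]].
  - split=> [a da|a b [Y FY Yab] [Z FZ Za]].
      by exists X => //; case: gX => h _ _; exact: theory_thm.
    have [YZ|ZY] := Ftot _ _ FY FZ.
      exists Z => //; case: (FP Z FZ) => [Z0|[h _ _]]; first by rewrite Z0 in Za.
      by apply: theory_mp Za => //; exact: YZ.
    exists Y => //; case: (FP Y FY) => [Y0|[h _ _]]; first by rewrite Y0 in Yab.
    by apply: theory_mp Yab _ => //; exact: ZY.
  - exists Y => //; case: (FP Y FY) => [Y0|[_ h _]]; first by rewrite Y0 in Ya.
    exact: h.
  - case: (FP Y FY) => [Y0|[_ _ h]]; first by rewrite Y0 in Yx.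
    exact: h Yx.
have [thT trT dT] : good T.
  case: T0 => // T0; case: (maxT (derives set0)); last by right.
  rewrite T0; split=> // /(_ _ (top_intro theory_nil)); exact.
(* The consequences of △a over [T] form a theory containing a, and it is △-closed because of △a ⊃
   △△a; by maximality it meets [D]. *)
have ext a : ~ T a -> exists2 x, D x & T (△ a ⊃ x)%F.
  move=> na; apply: contrapT => nx.
  have Ta : T `<=` [set x | T (△ a ⊃ x)%F] by move=> x; exact: imp_weak.
  case: (maxT [set x | T (△ a ⊃ x)%F]).
    split=> // /(_ a); apply: contra_not na; apply.
    exact/(theory_thm thT)/derives_ax_GTri/ax_tri_elim.
  right; split=> [|x /= Tx|x Dx Tx]; first exact: theory_imp.
    apply: (imp_trans thT (b := (△ △ a)%F)).
      exact/(theory_thm thT)/derives_ax_GTri/ax_tri_tri.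
    apply: theory_mp (trT _ Tx) => //.
    exact/(theory_thm thT)/derives_ax_GTri/ax_tri_imp.
  by apply: nx; exists x.
exists T; split=> //; split=> //.
  move=> a b Tab; apply: contrapT => /not_orP[/ext[x Dx Tx] /ext[y Dy Ty]].
  have [z [Dz xz yz]] := Ddir _ _ Dx Dy.
  case: (dT z Dz); apply: (theory_mp thT (a := (△ a ⊔ △ b)%F)).
    by apply: or_imp => //;
      [apply: imp_trans Tx _ | apply: imp_trans Ty _] => //; exact: theory_thm.
  apply: theory_mp (trT _ Tab) => //.
  exact/(theory_thm thT)/derives_ax_GTri/ax_tri_or.
by move=> Tbot; apply: (dT d0 Dd0); exact: theory_mp (bot_imp thT _) Tbot.
Qed.

(** * Semantics and soundness *)

Section Semantics.
Variable R : realType.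
Implicit Types x y z t : R.

(** Residuation; the bound on [x] is there because [gimp] never exceeds 1. *)
Lemma le_gimp x y z : x <= 1 -> (x <= gimp y z) = (Num.min x y <= z).
Proof.
move=> x1; rewrite /gimp ge_min; case: (leP y z) => yz; last by rewrite orbF.
by rewrite x1 orbT.
Qed.

Lemma gimp_itv x y : 0 <= y <= 1 -> 0 <= gimp x y <= 1.
Proof. by rewrite /gimp; case: ifP => // _ _; rewrite ler01 lexx. Qed.

Lemma gand_itv x y : 0 <= x <= 1 -> 0 <= y <= 1 -> 0 <= gand x y <= 1.
Proof. by rewrite /gand minEle; case: ifP. Qed.

Lemma inf_itv (E : set R) :
  E !=set0 -> (forall x, E x -> 0 <= x <= 1) -> 0 <= inf E <= 1.
Proof.
move=> E0 E01; apply/andP; split.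
  by apply: lb_le_inf => // x /E01/andP[].
have [x Ex] := E0; have /andP[_ x1] := E01 x Ex.
apply: le_trans x1; apply: ge_inf => //.
by exists 0 => y /E01/andP[].
Qed.

Lemma sup_itv (E : set R) :
  E !=set0 -> (forall x, E x -> 0 <= x <= 1) -> 0 <= sup E <= 1.
Proof.
move=> E0 E01; apply/andP; split; last first.
  by apply: ge_sup => // x /E01/andP[].
have [x Ex] := E0; have /andP[x0 _] := E01 x Ex.
apply: le_trans x0 _; apply: ub_le_sup => //.
by exists 1 => y /E01/andP[].
Qed.

Section Model.
Variable M : model R.
Implicit Types (a b c : fml) (w : M).

Lemma range_nonempty (f : M -> R) : range f !=set0.
Proof. by have [w] := world_inhabited M; exists (f w), w. Qed.

Lemma eval_itv a w : 0 <= eval a w <= 1.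
Proof.
elim: a w => [n|a IHa|a IHa|a IHa b IHb|a IHa b IHb|a IHa b IHb|a IHa|a IHa] w /=.
- exact: valuation_itv.
- by rewrite /gneg; case: ifP; rewrite ?lexx ler01.
- by rewrite /gtri; case: ifP; rewrite ?lexx ler01.
- exact: gand_itv.
- by rewrite /gor maxEle; case: ifP.
- exact: gimp_itv.
- apply: inf_itv; first exact: range_nonempty.
  by move=> _ [w' _ <-]; exact: gimp_itv.
- apply: sup_itv; first exact: range_nonempty.
  by move=> _ [w' _ <-]; apply: gand_itv => //; exact: acc_itv.
Qed.

Lemma eval_ge0 a w : 0 <= eval a w. Proof. by case/andP: (eval_itv a w). Qed.
Lemma eval_le1 a w : eval a w <= 1. Proof. by case/andP: (eval_itv a w). Qed.

Lemma acc_le1 w w' : acc w w' <= 1. Proof. by case/andP: (acc_itv w w'). Qed.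

Lemma eval_imp1 a b w : (eval (a ⊃ b)%F w = 1) <-> (eval a w <= eval b w).
Proof.
split=> [|ab]; last by rewrite /= /gimp ab.
rewrite /= /gimp; case: ifP => // /negbT; rewrite -ltNge => ba b1.
by have := eval_le1 a w; rewrite -b1 leNgt ba.
Qed.

(** With [t <= eval a w] read as forcing of a at stage t, this is the intuitionistic clause for
    implication. Nested implications can then be checked by introducing one smaller bound after
    another. *)
Lemma le_eval_imp a b w t : t <= 1 ->
  t <= eval (a ⊃ b)%F w <->
  forall u, u <= t -> u <= eval a w -> u <= eval b w.
Proof.
move=> t1; rewrite [X in _ <= X]/= le_gimp//; split=> [tab u ut ua|h].
  by apply: le_trans tab; rewrite le_min ut ua.
by apply: h; rewrite ge_min lexx ?orbT.
Qed.

Lemma eval_imp_intro a b w :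
  (forall t, t <= 1 -> t <= eval a w -> t <= eval b w) ->
  eval (a ⊃ b)%F w = 1.
Proof. by move=> h; apply/eval_imp1/h => //; exact: eval_le1. Qed.

Lemma le_eval_box a w t : t <= 1 ->
  t <= eval (□ a)%F w <-> forall w', Num.min t (acc w w') <= eval a w'.
Proof.
move=> t1; split=> [ta w'|h /=]; last first.
  apply: lb_le_inf; first exact: range_nonempty.
  by move=> _ [w' _ <-]; rewrite le_gimp.
rewrite -le_gimp//; apply: le_trans ta _; apply: ge_inf; last by exists w'.
exists 0 => _ [v _ <-].
by have /andP[] := @gimp_itv (acc w v) _ (eval_itv a v).
Qed.

Lemma eval_dia_le a w t :
  eval (◇ a)%F w <= t <-> forall w', Num.min (acc w w') (eval a w') <= t.
Proof.
split=> [ta w'|h /=]; last first.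
  apply: ge_sup; first exact: range_nonempty.
  by move=> _ [w' _ <-]; exact: h.
apply: le_trans ta; apply: ub_le_sup; last by exists w'.
exists 1 => _ [v _ <-].
by have /andP[_ h] := gand_itv (acc_itv w v) (eval_itv a v); exact: h.
Qed.

Lemma eval_subst_ax_GTri s a w : ax_GTri a -> eval (subst s a) w = 1.
Proof.
have gtri01 (x : R) : gtri x = 0 \/ gtri x = 1 /\ x = 1.
  by rewrite /gtri; case: eqP; [right | left].
(* The five △ schemas are moved to the front and computed by cases on [gtri]; most of the others use
   decreasing bounds t, u, v. *)
case=> {}a => [b c|b|b|b c|b|b|b c|b c|b c|b||b||b|b||]; rewrite [subst _ _]/=; last 5 first.
- rewrite /= /gneg /gor /gtri; case: (_ == 1); rewrite ?eqxx ?oner_eq0.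
    by rewrite max_l// ler01.
  by rewrite max_r// ler01.
- apply: eval_imp_intro => t t1 tab; apply/le_eval_imp => // u ut /= ua.
  case: (gtri01 (eval (subst s a) w)) ua => [->|[-> a1] ua].
    by move=> u0; apply: le_trans u0 _; rewrite /gtri; case: ifP.
  move: (le_trans ut tab) => /=.
  case: (gtri01 (gimp (eval (subst s a) w) (eval (subst s b) w))) => [->|[-> /eval_imp1]].
    by move=> u0; apply: le_trans u0 _; rewrite /gtri; case: ifP.
  rewrite a1 => b1; have -> : eval (subst s b) w = 1.
    by apply/eqP; rewrite eq_le b1 eval_le1.
  by rewrite /gtri eqxx.
- apply/eval_imp1; rewrite /= /gor le_max [X in gtri X]maxEle.
  by case: ifP => _; rewrite lexx ?orbT.
- apply/eval_imp1; rewrite /= /gtri; case: eqP => [->//|_]; exact: eval_ge0.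
- by apply/eval_imp1; rewrite /= /gtri; case: (eval _ w == 1); rewrite ?eqxx//; case: ifP.
- apply: eval_imp_intro => t t1 tab; apply/le_eval_imp => // u ut ubc.
  apply/le_eval_imp => [|v vu va]; first exact: le_trans t1.
  move/le_eval_imp: ubc; apply=> //; first exact: le_trans t1.
  by move/le_eval_imp: tab; apply=> //; exact: le_trans ut.
- by apply/eval_imp1; rewrite le_max lexx.
- by apply/eval_imp1; rewrite le_max lexx orbT.
- apply: eval_imp_intro => t t1 tac; apply/le_eval_imp => // u ut ubc.
  have u1 := le_trans ut t1.
  apply/le_eval_imp => // v vu; rewrite [X in _ <= X]/= le_max => /orP[va|vb].
    by move/le_eval_imp: tac; apply=> //; exact: le_trans ut.
  by move/le_eval_imp: ubc; apply.
- by apply/eval_imp1; rewrite ge_min lexx.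
- by apply/eval_imp1; rewrite ge_min lexx orbT.
- apply: eval_imp_intro => t t1 tab; apply/le_eval_imp => // u ut uac.
  have u1 := le_trans ut t1.
  apply/le_eval_imp => // v vu va; rewrite [X in _ <= X]/= le_min; apply/andP; split.
    by move/le_eval_imp: tab; apply=> //; exact: le_trans ut.
  by move/le_eval_imp: uac; apply.
- apply: eval_imp_intro => t t1 tabc; apply/le_eval_imp => // u ut.
  have u1 := le_trans ut t1; rewrite [X in _ <= X]/= le_min => /andP[ua ub].
  move/le_eval_imp: tabc => /(_ t1 u ut ua) /le_eval_imp; exact.
- apply: eval_imp_intro => t t1 tabc; apply/le_eval_imp => // u ut ua.
  have u1 := le_trans ut t1; apply/le_eval_imp => // v vu vb.
  move/le_eval_imp: tabc; apply=> //; first exact: le_trans ut.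
  by rewrite [X in _ <= X]/= le_min vb (le_trans vu ua).
- apply: eval_imp_intro => t t1 ta; apply/le_eval_imp => // u ut ua.
  move: (le_trans ut ta); rewrite [X in _ <= X]/= /gneg; case: eqP => [a0 _|_ u0].
    by apply: le_trans ua _; rewrite a0 eval_ge0.
  by apply: le_trans u0 _; exact: eval_ge0.
- apply/eval_imp1; rewrite /= /gneg /gimp lexx oner_eq0.
  by rewrite [_ == 0]eq_le eval_ge0 andbT.
- rewrite /= /gor /gimp; case: (leP (eval (subst s a) w)) => [_|/ltW ->].
    by apply/max_l; case: ifP => // _; exact: eval_le1.
  by apply/max_r; exact: eval_le1.
Qed.

Lemma eval_subst_thm_GTri s a w : thm_GTri a -> eval (subst s a) w = 1.
Proof.
elim=> {a} [a _ /eval_subst_ax_GTri //|a b _ ab _ a1|a _ a1] /=.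
  by apply/eqP; rewrite eq_le eval_le1 -{1}a1; move/eval_imp1: ab.
by rewrite /gtri a1 eqxx.
Qed.

Lemma eval_ax_KbiG a w : ax_KbiG a -> eval a w = 1.
Proof.
case=> {a} [s a|| a b|a b|a b|a b].
- exact: eval_subst_thm_GTri.
- have : eval (◇ fbot)%F w <= 0.
    apply/eval_dia_le => w'; rewrite ge_min; apply/orP; right.
    by rewrite /= /gneg /gimp lexx oner_eq0.
  have := eval_ge0 (◇ fbot)%F w; move: (◇ fbot)%F => d d0 d1 /=.
  by rewrite /gneg eq_le d0 d1.
- apply: eval_imp_intro => t t1 tab; apply/le_eval_imp => // u ut ua.
  have u1 := le_trans ut t1.
  apply/le_eval_box => // w'; set v := Num.min _ _.
  have v1 : v <= 1 by rewrite ge_min u1.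
  move/le_eval_box: ua => /(_ u1 w') va.
  have ut' := le_trans ut tab.
  move/le_eval_box: ut' => /(_ u1 w') vab.
  by move/le_eval_imp: vab; apply.
- apply/eval_imp1/eval_dia_le => w'.
  have da := (eval_dia_le a w (eval (◇ a)%F w)).1 (lexx _) w'.
  have db := (eval_dia_le b w (eval (◇ b)%F w)).1 (lexx _) w'.
  rewrite [X in _ <= X]/= le_max; apply/orP.
  rewrite [X in Num.min _ X]/= /gor maxEle; case: ifP => _; [right|left];
    [exact: db|exact: da].
- apply/eval_imp1/eval_dia_le => w'; apply/le_eval_imp.
    by rewrite ge_min acc_le1.
  move=> u; rewrite le_min => /andP[ur uab] ua.
  have u1 : u <= 1 by apply: le_trans ua _; exact: eval_le1.
  have db := (eval_dia_le b w (eval (◇ b)%F w)).1 (lexx _) w'.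
  apply: le_trans db; rewrite le_min ur /=.
  move/le_eval_imp: uab; apply=> //.
  move/le_eval_box: ua => /(_ u1 w'); apply: le_trans.
  by rewrite le_min lexx.
(* A bound u below both the degree of access and the value of a at w' is below ◇a at w, hence below
   □b at w, hence below b at w'. *)
- apply: eval_imp_intro => t t1 tab; apply/le_eval_box => // w'.
  have m1 : Num.min t (acc w w') <= 1 by rewrite ge_min t1.
  apply/le_eval_imp => // u; rewrite le_min => /andP[ut ur] ua.
  have u1 := le_trans ut t1.
  have da := (eval_dia_le a w (eval (◇ a)%F w)).1 (lexx _) w'.
  have : u <= eval (□ b)%F w.
    move/le_eval_imp: tab; apply=> //; apply: le_trans da.
    by rewrite le_min ur.
  move=> /le_eval_box => /(_ u1 w'); apply: le_trans.
  by rewrite le_min lexx.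
Qed.

End Model.
End Semantics.

Lemma le_inf_hyps (R : realType) (M : model R) (w : M) (G : set fml) (x : R) :
  x <= inf (1 |` [set eval a w | a in G]) <->
  x <= 1 /\ forall a, G a -> x <= eval a w.
Proof.
have lbE : has_lbound (1 |` [set eval a w | a in G]).
  by exists 0 => _ [->|[b _ <-]]; [exact: ler01 | exact: eval_ge0].
split=> [xE|[x1 xG]].
  split=> [|a Ga]; apply: le_trans xE _; apply: ge_inf => //; first by left.
  by right; exists a.
apply: lb_le_inf; first by exists 1; left.
by move=> _ [->|[a Ga <-]] //; exact: xG.
Qed.

Lemma soundness (R : realType) (G : set fml) (c : fml) :
  derives G c -> entails R G c.
Proof.
elim=> {G c} [G a Ga|G a ax|G a b _ IHab _ IHa|G a _ IH|G a _ IH|G a b _ IH] M w.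
all: have [h1 hG] := (le_inf_hyps w G _).1 (lexx _).
- exact: hG.
- by rewrite (eval_ax_KbiG w ax).
- by move/le_eval_imp: (IHab M w); apply.
(* In the three restricted rules the premise has no assumptions, so its induction hypothesis says
   that it has value 1 at every world of every model. *)
all: have val1 v : inf (1 |` [set eval x v | x in set0]) = 1 :> R
  by rewrite image_set0 setU0 inf1.
- move: (IH M w); rewrite val1 => a1; apply: le_trans h1 _.
  by rewrite /= /gtri eq_le a1 eval_le1.
- apply: le_trans h1 _; apply/le_eval_box => // w'.
  by move: (IH M w'); rewrite val1; apply: le_trans; rewrite ge_min lexx.
- apply: le_trans h1 _; rewrite le_eqVlt; apply/orP; left; rewrite eq_sym.
  apply/eqP/eval_imp1/eval_dia_le => w'.
  apply: le_trans ((eval_dia_le b w (eval (◇ b)%F w)).1 (lexx _) w').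
  rewrite le_min !ge_min lexx /=; apply/orP; right.
  apply/eval_imp1/eqP; rewrite eq_le eval_le1 /=.
  by move: (IH M w'); rewrite val1.
Qed.

(** * Valuations in [0,1] representing a prime theory on a finite set *)

Section Representation.
Variable R : realType.
Implicit Types (T : fml -> Prop) (F : seq fml) (v : fml -> R).

(** Only the order on [F] and the two end points are prescribed: they determine the Gödel
    connectives, as [rep_and] to [rep_tri] show. *)
Record represents T F v : Prop := Represents {
  rep_itv : forall a, 0 <= v a <= 1;
  rep_le : {in F &, forall a b, v a <= v b <-> T (a ⊃ b)%F};
  rep_top : v ftop = 1;
  rep_bot : v fbot = 0
}.

(* With [m] the running maximum of the lower bounds, [M] the running minimum
   of the upper bounds and [k] the normalised rank, [(1 - k) m + k M] is
   strictly increasing because [m], [M], [k] are monotone and [m < M]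
   across strict steps. *)
Lemma representation_between T F (lo up : fml -> R) :
  prime_theory T -> ftop \in F -> fbot \in F ->
  (forall a, 0 <= lo a <= 1) -> (forall a, 0 <= up a <= 1) ->
  lo ftop = 1 -> up fbot = 0 ->
  {in F &, forall a b, T (a ⊃ b)%F -> lo a <= up b} ->
  {in F &, forall a b, ~ T (b ⊃ a)%F -> lo a < up b} ->
  exists2 v, represents T F v & {in F, forall a, lo a <= v a <= up a}.
Proof.
move=> pT topF botF lo01 up01 lo1 up0 loup loup_lt; have thT : theory T := pT.
have trans a b c := @imp_trans T thT a b c.
have refl a := imp_refl thT a.
pose m a : R := \big[Num.max/0]_(b <- F | `[< T (b ⊃ a)%F >]) lo b.
pose M a : R := \big[Num.min/1]_(b <- F | `[< T (a ⊃ b)%F >]) up b.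
pose k a : R := (count (fun b => `[< T (b ⊃ a)%F >]) F)%:R / (size F)%:R.
have sF : 0 < (size F)%:R :> R.
  by rewrite ltr0n; move: topF; case: (F).
have k01 a : 0 <= k a <= 1.
  rewrite /k divr_ge0 ?ler0n//= ler_pdivrMr// mul1r ler_nat; exact: count_size.
have k_lt a b : b \in F -> ~ T (b ⊃ a)%F -> k a < k b.
  move=> bF nba; rewrite /k ltr_pM2r ?invr_gt0// ltr_nat.
  have ab := prime_not_imp pT nba.
  have sub : subpred (fun c => `[< T (c ⊃ a)%F >]) (fun c => `[< T (c ⊃ b)%F >]).
    by move=> c /asboolP ca; apply/asboolP; exact: trans ca ab.
  (* The count is strictly larger because b is below itself but not below a. *)
  rewrite -[ltnRHS]size_filter -(count_predC (fun c => `[< T (c ⊃ a)%F >])).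
  rewrite -addn1 leq_add//; last first.
    rewrite -has_count; apply/hasP; exists b; last exact/asboolP.
    by rewrite mem_filter bF andbT; apply/asboolP; exact: refl.
  by rewrite count_filter; apply: sub_count => c /= ca; rewrite ca; exact: sub.
have k_le a b : T (a ⊃ b)%F -> k a <= k b.
  move=> ab; rewrite /k ler_pM2r ?invr_gt0// ler_nat; apply: sub_count.
  by move=> c /asboolP ca; apply/asboolP; exact: trans ca ab.
have m_le a b : T (a ⊃ b)%F -> m a <= m b.
  move=> ab; apply: sub_bigmax => c /asboolP ca; apply/asboolP.
  exact: trans ca ab.
have M_le a b : T (a ⊃ b)%F -> M a <= M b.
  move=> ab; apply: sub_bigmin => c /asboolP bc; apply/asboolP.
  exact: trans ab bc.
have mM a : m a <= M a.
  rewrite /m /M big_seq_cond [leRHS]big_seq_cond.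
  apply: bigmax_le => [|b /andP[bF /asboolP ba]]; apply: le_bigmin => //.
  - by move=> c _; case/andP: (up01 c).
  - by case/andP: (lo01 b).
  - by move=> c /andP[cF /asboolP ac]; apply: loup => //; exact: trans ba ac.
have mM_lt a b : ~ T (b ⊃ a)%F -> m a < M b.
  move=> nba; have nab c d : T (c ⊃ a)%F -> T (b ⊃ d)%F -> ~ T (d ⊃ c)%F.
    by move=> ca bd dc; apply: nba; exact: trans (trans _ _ _ bd dc) ca.
  (* An empty minimum defaults to 1, so lo c < 1 is needed as well; it is read off as lo c < up
     ftop, with [ftop] above b. *)
  have up1 : up ftop = 1.
    have /andP[_ up1] := up01 ftop; apply/eqP; rewrite eq_le up1 -lo1.
    by rewrite loup//.
  have btop : T (b ⊃ ftop)%F by apply: imp_weak => //; exact: top_intro.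
  have bota : T (fbot ⊃ a)%F by exact: bot_imp.
  rewrite /m /M big_seq_cond [ltRHS]big_seq_cond.
  apply: bigmax_lt => [|c /andP[cF /asboolP ca]]; apply: lt_bigmin => //.
  - move=> d /andP[dF /asboolP bd]; have /andP[l0 _] := lo01 fbot.
    by apply: le_lt_trans l0 _; apply: loup_lt => //; exact: nab.
  - by rewrite -up1; apply: loup_lt => //; exact: nab.
  - by move=> d /andP[dF /asboolP bd]; apply: loup_lt => //; exact: nab.
have m0 a : 0 <= m a by exact: bigmax_ge_id.
have M1 a : M a <= 1 by exact: bigmin_le_id.
pose v a := (1 - k a) * m a + k a * M a.
have mvM a : m a <= v a <= M a.
  by have /andP[? ?] := k01 a; have := mM a; rewrite /v; nra.
have bounds : {in F, forall a, lo a <= v a <= up a}.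
  move=> a aF; have /andP[mv vM] := mvM a; apply/andP; split.
    by apply: le_trans mv; apply: le_bigmax_seq => //; exact/asboolP.
  by apply: le_trans vM _; apply: ge_bigmin_seq => //; exact/asboolP.
have v01 a : 0 <= v a <= 1.
  have /andP[mv vM] := mvM a.
  by rewrite (le_trans (m0 a) mv) (le_trans vM (M1 a)).
exists v => //; split=> //.
- move=> a b aF bF; split=> [|ab].
    apply: contraPP => nab; apply/negP; rewrite -ltNge.
    have ba := prime_not_imp pT nab.
    have /andP[? ?] := k01 a; have /andP[? ?] := k01 b.
    have := k_lt _ _ aF nab; have := m_le _ _ ba; have := M_le _ _ ba.
    have := mM_lt _ _ nab; rewrite /v -(subr_gt0 (m b)) -(subr_gt0 (k b)).
    (* Since m b <= m a and M b <= M a, the difference v a - v b is at least (k a - k b)(M a - m b),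
       the positive product given to [nra]. *)
    move=> mM_gt MM mm k_gt; have := mulr_gt0 k_gt mM_gt; nra.
  have /andP[? ?] := k01 a; have := k_le _ _ ab; have := m_le _ _ ab.
  have := M_le _ _ ab; have := mM b; rewrite /v; nra.
- have /andP[_ v1] := v01 ftop; have /andP[l1 _] := bounds _ topF.
  by apply/eqP; rewrite eq_le v1 -lo1.
- have /andP[v0 _] := v01 fbot; have /andP[_ u0] := bounds _ botF.
  by apply/eqP; rewrite eq_le v0 -up0 u0.
Qed.

Lemma representation_exists T F :
  prime_theory T -> ftop \in F -> fbot \in F -> exists v, represents T F v.
Proof.
move=> pT topF botF; have thT : theory T := pT.
pose lo (a : fml) : R := if a == ftop then 1 else 0.
pose up (a : fml) : R := if a == fbot then 0 else 1.
have [||||||v vT _] := @representation_between T F lo up pT topF botF.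
- by move=> a; rewrite /lo; case: ifP; rewrite lexx ler01.
- by move=> a; rewrite /up; case: ifP; rewrite lexx ler01.
- by rewrite /lo eqxx.
- by rewrite /up eqxx.
- move=> a b _ _; rewrite /lo /up; case: eqP => [->|_]; case: eqP => [->|_] //.
  by move=> /(prime_top_imp pT)/(prime_bot pT).
- move=> a b _ _; rewrite /lo /up; case: eqP => [->|_]; case: eqP => [->|_] //.
  + by case; apply: imp_weak => //; exact: top_intro.
  + by case; apply: imp_weak => //; exact: top_intro.
  + by case; exact: bot_imp.
by exists v.
Qed.

Section Rep.
Variables (T : fml -> Prop) (F : seq fml) (v : fml -> R).
Hypotheses (pT : prime_theory T) (vT : represents T F v).
Hypotheses (topF : ftop \in F) (botF : fbot \in F).
Let thT : theory T := pT.

Lemma rep_lt : {in F &, forall a b, v a < v b <-> ~ T (b ⊃ a)%F}.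
Proof.
move=> a b aF bF; rewrite ltNge; split=> [/negP h|h].
  by move=> /(rep_le vT bF aF).
by apply/negP => /(rep_le vT bF aF).
Qed.

Lemma rep_eq1 : {in F, forall a, T a -> v a = 1}.
Proof.
move=> a aF Ta; have /andP[_ a1] := rep_itv vT a.
apply/eqP; rewrite eq_le a1 -(rep_top vT); apply/(rep_le vT) => //.
exact: imp_weak.
Qed.

Lemma rep_eq0 : {in F, forall a, T (a ⊃ fbot)%F -> v a = 0}.
Proof.
move=> a aF Ta; have /andP[a0 _] := rep_itv vT a.
by apply/eqP; rewrite eq_le a0 andbT -(rep_bot vT); apply/(rep_le vT).
Qed.

Lemma rep_eq : {in F &, forall a b, T (a ⊃ b)%F -> T (b ⊃ a)%F -> v a = v b}.
Proof.
move=> a b aF bF ab ba; apply/eqP; rewrite eq_le.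
by apply/andP; split; apply/(rep_le vT).
Qed.

Lemma rep_and a b : a \in F -> b \in F -> (a ⊓ b)%F \in F ->
  v (a ⊓ b)%F = gand (v a) (v b).
Proof.
move=> aF bF abF; rewrite /gand; case: (leP (v a) (v b)) => [/(rep_le vT aF bF) ab|].
  by apply: rep_eq => //; [exact: and_impl | apply: imp_and => //; exact: imp_refl].
move=> /(rep_lt bF aF)/(prime_not_imp pT) ba.
by apply: rep_eq => //; [exact: and_impr | apply: imp_and => //; exact: imp_refl].
Qed.

Lemma rep_or a b : a \in F -> b \in F -> (a ⊔ b)%F \in F ->
  v (a ⊔ b)%F = gor (v a) (v b).
Proof.
move=> aF bF abF; rewrite /gor; case: (leP (v a) (v b)) => [/(rep_le vT aF bF) ab|].
  by apply: rep_eq => //; [apply: or_imp => //; exact: imp_refl | exact: or_impr].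
move=> /(rep_lt bF aF)/(prime_not_imp pT) ba.
by apply: rep_eq => //; [apply: or_imp => //; exact: imp_refl | exact: or_impl].
Qed.

Lemma rep_imp a b : a \in F -> b \in F -> (a ⊃ b)%F \in F ->
  v (a ⊃ b)%F = gimp (v a) (v b).
Proof.
move=> aF bF abF; rewrite /gimp; case: (leP (v a) (v b)) => [/(rep_le vT aF bF) ab|].
  exact: rep_eq1.
move=> /(rep_lt bF aF)/(prime_imp_imp pT) ba.
apply: rep_eq => //; apply: (imp_curry thT); exact: and_impl.
Qed.

Lemma rep_neg a : a \in F -> (~~~ a)%F \in F -> v (~~~ a)%F = gneg (v a).
Proof.
move=> aF naF; rewrite /gneg; case: eqP => [a0|na0].
  apply: rep_eq1 => //; apply: theory_mp (imp_bot_neg thT a) _ => //.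
  by apply/(rep_le vT) => //; rewrite a0 (rep_bot vT).
apply: rep_eq0 => //; apply: imp_trans (neg_imp_bot thT a) _ => //.
by apply: prime_imp_imp => // /(rep_eq0 aF).
Qed.

Lemma rep_tri a : a \in F -> (△ a)%F \in F -> v (△ a)%F = gtri (v a).
Proof.
move=> aF naF; rewrite /gtri; case: eqP => [a1|na1].
  apply: rep_eq1 => //; apply: (prime_tri pT); apply/(prime_top_imp pT).
  by apply/(rep_le vT) => //; rewrite a1 (rep_top vT).
by apply: rep_eq0 => //; apply: prime_tri_bot => // /(rep_eq1 aF).
Qed.

End Rep.

(** As [F] is finite, no value lies strictly between x and z, the least of y and the values above x;
    d' and d cut this interval into thirds. They serve as threshold: low values of a successor stay
    below d', high values and the degree of access reach d. *)
Lemma gap_above F v x y : x < y ->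
  exists d' d, [/\ x < d', d' < d, d < y & {in F, forall a, v a < d -> v a <= x}].
Proof.
move=> xy; pose z := \big[Num.min/y]_(a <- F | x < v a) v a.
have xz : x < z by exact: lt_bigmin.
have zy : z <= y by exact: bigmin_le_id.
exists ((x + x + z) / 3), ((x + z + z) / 3); split; [lra|lra|lra|].
move=> a aF; apply: contraTT; rewrite -ltNge -leNgt => xa.
have : z <= v a by exact: ge_bigmin_seq.
lra.
Qed.

Lemma gap_below F v x y : y < x ->
  exists d' d, [/\ y < d', d' < d, d < x & {in F, forall a, v a < x -> v a < d'}].
Proof.
move=> yx; pose z := \big[Num.max/y]_(a <- F | v a < x) v a.
have zx : z < x by exact: bigmax_lt.
have yz : y <= z by exact: bigmax_ge_id.
exists ((x + z + z) / 3), ((x + x + z) / 3); split; [lra|lra|lra|].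
move=> a aF ax.
have : v a <= z by exact: le_bigmax_seq.
lra.
Qed.

End Representation.

(** * Successor theories from the Fischer Servi axioms *)

(* [T'] can be a successor of [T] at a degree above a threshold: [hi] is to
   lie above the threshold and [lw] below it, and [lwd a] says that [◇ a] is
   below the threshold in [T]. *)
Record cut_successor (T T' hi lw lwd : fml -> Prop) : Prop := CutSuccessor {
  cut_top : hi ftop;
  cut_bot : lwd fbot;
  cut_lwd : forall a, lwd a -> lw a;
  cut_lt : forall a b, hi a -> lw b -> ~ T' (a ⊃ b)%F;
  cut_dia_box : forall a b, lwd b -> T (◇ b ⊃ □ a)%F -> T' (b ⊃ a)%F;
  cut_box_dia : forall a b, lwd b -> T' (a ⊃ b)%F -> T (□ a ⊃ ◇ b)%F
}.

Section CutSuccessor.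
Variables (T : fml -> Prop) (pT : prime_theory T).
Let thT : theory T := pT.

(** [ax_dia_imp] puts ◇(a ⊃ b) below □a ⊃ ◇b, which collapses to ◇b when it fails in [T]. *)
Lemma not_box_dia_imp a b : ~ T (□ a ⊃ ◇ b)%F -> T (◇ (a ⊃ b) ⊃ ◇ b)%F.
Proof.
move=> /(prime_imp_imp pT) h; apply: imp_trans h => //; apply: imp_curry => //.
have thab := theory_imp thT (◇ (a ⊃ b) ⊓ □ a)%F.
by apply: (dia_imp thab (a := a)); [exact: and_impl | exact: and_impr].
Qed.

(** [T'] avoids every a ⊃ f with □a strictly above □f. These formulas are directed, by totality and
    [box_and], and none is a theorem, by monotonicity of □. Such a are [hi]; the formulas below f in
    [T'] are [lw]. *)
Lemma cut_successor_box f : ~ T (□ f)%F ->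
  exists T' hi lw, [/\ prime_theory T',
    cut_successor T T' hi lw (fun a => T (◇ a ⊃ □ f)%F), lw f &
    forall a, ~ T (□ a ⊃ □ f)%F -> hi a].
Proof.
move=> nf; pose D x := exists2 a, ~ T (□ a ⊃ □ f)%F & x = (a ⊃ f)%F.
have hi_thm a : T (□ a)%F -> ~ T (□ a ⊃ □ f)%F.
  by move=> Ta h; apply: nf; exact: theory_mp h Ta.
have ntop : ~ T (□ ftop ⊃ □ f)%F.
  by apply: hi_thm; apply: box_thm => //; exact: top_intro theory_nil.
have [|||T' [pT' DT']] := @prime_extension D (ftop ⊃ f)%F.
- by exists ftop.
- move=> _ _ [a na ->] [b nb ->]; exists (a ⊓ b ⊃ f)%F; split.
  + exists (a ⊓ b)%F => // h.
    have [ab|ba] := prime_total pT (□ a)%F (□ b)%F.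
      apply: na; apply: imp_trans h => //.
      by apply: (box_and (theory_imp thT _)) => //; exact: imp_refl.
    apply: nb; apply: imp_trans h => //.
    by apply: (box_and (theory_imp thT _)) => //; exact: imp_refl.
  + have thd := theory_imp theory_nil (a ⊃ f)%F.
    by apply: (imp_trans thd (and_impl thd a b)); exact: imp_refl theory_nil _.
  + have thd := theory_imp theory_nil (b ⊃ f)%F.
    by apply: (imp_trans thd (and_impr thd a b)); exact: imp_refl theory_nil _.
- move=> _ [a na ->] af; apply: na.
  by apply: (box_mon (theory_imp thT _)) af _; exact: imp_refl.
have thT' : theory T' := pT'.
have hi_lt a : ~ T (□ a ⊃ □ f)%F -> ~ T' (a ⊃ f)%F.
  by move=> na; apply: DT'; exists a.
(* By [ax_FS2], □(a ⊃ f) is in [T], so a ⊃ f is [hi] and lies strictly above f in [T']; it would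
   collapse to f if it failed there. *)
have lwd_lw a : T (◇ a ⊃ □ f)%F -> T' (a ⊃ f)%F.
  move=> af; apply: contrapT => /(prime_imp_imp pT'); apply: hi_lt.
  by apply: hi_thm; exact: dia_box_imp.
exists T', (fun a => ~ T (□ a ⊃ □ f)%F), (fun a => T' (a ⊃ f)%F).
split=> //; last exact: imp_refl.
split=> //.
- exact: dia_bot_imp.
- by move=> a b /hi_lt na bf ab; apply: na; exact: imp_trans ab bf.
(* If b ⊃ a failed in [T'], it would be [hi] by [ax_FS2] and yet lie below a, hence below b and
   f. *)
- move=> a b /lwd_lw bf ba; apply: contrapT => nba.
  apply: (hi_lt (b ⊃ a)%F); first by apply: hi_thm; exact: dia_box_imp.
  apply: imp_trans (prime_imp_imp pT' nba) _ => //.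
  exact: imp_trans (prime_not_imp pT' nba) bf.
(* Otherwise ◇(a ⊃ b) is below ◇b and so below □f, which puts a ⊃ b below f in [T']; as a ⊃ b is in
   [T'], so is f, against [ftop] being [hi]. *)
- move=> a b bf ab; apply: contrapT => /not_box_dia_imp nab.
  apply: (hi_lt _ ntop); apply: imp_weak => //.
  apply: theory_mp ab => //; apply: lwd_lw; exact: imp_trans nab bf.
Qed.

(** [T'] avoids every f ⊓ a ⊃ b with □a above ◇f and ◇b strictly below ◇f. [box_and] and [dia_or]
    make these formulas directed, and [dia_and_box] shows that none is a theorem. Being [hi] means
    lying strictly above all [lw] formulas in [T'], which covers f and all such a. *)
Lemma cut_successor_dia f : ~ T (◇ f ⊃ fbot)%F ->
  exists T' hi lw, [/\ prime_theory T',
    cut_successor T T' hi lw (fun a => ~ T (◇ f ⊃ ◇ a)%F), hi f &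
    forall a, T (◇ f ⊃ □ a)%F -> hi a].
Proof.
move=> nf.
pose D x := exists a b,
  [/\ T (◇ f ⊃ □ a)%F, ~ T (◇ f ⊃ ◇ b)%F & x = (f ⊓ a ⊃ b)%F].
have thf := theory_imp thT (◇ f)%F.
have ff := imp_refl thT (◇ f)%F.
have nbot : ~ T (◇ f ⊃ ◇ fbot)%F.
  by move=> h; apply: nf; apply: imp_trans h _ => //; exact: dia_bot_imp.
have boxtop : T (◇ f ⊃ □ ftop)%F.
  by apply: (box_thm thf); exact: top_intro theory_nil.
have [|||T' [pT' DT']] := @prime_extension D (f ⊓ ftop ⊃ fbot)%F.
- by exists ftop, fbot.
- move=> _ _ [a1 [b1 [a1T b1T ->]]] [a2 [b2 [a2T b2T ->]]].
  have thn := theory_nil.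
  exists (f ⊓ (a1 ⊓ a2) ⊃ b1 ⊔ b2)%F; split.
  + exists (a1 ⊓ a2)%F, (b1 ⊔ b2)%F; split=> //; first exact: (box_and thf).
    move=> /imp_trans -/(_ thT _ (dia_or thT b1 b2)) /(prime_imp_or pT).
    by case.
  + have mon : derives set0 (f ⊓ (a1 ⊓ a2) ⊃ f ⊓ a1)%F.
      apply: imp_and; rewrite //; first exact: and_impl.
      by apply: (imp_trans thn (and_impr thn _ _)); exact: and_impl.
    have thd := theory_imp thn (f ⊓ a1 ⊃ b1)%F.
    apply: (imp_trans thd); first exact: imp_weak thn _ _ mon.
    apply: (imp_trans thd (imp_refl thn _)).
    exact: imp_weak thn _ _ (or_impl thn _ _).
  + have mon : derives set0 (f ⊓ (a1 ⊓ a2) ⊃ f ⊓ a2)%F.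
      apply: imp_and; rewrite //; first exact: and_impl.
      by apply: (imp_trans thn (and_impr thn _ _)); exact: and_impr.
    have thd := theory_imp thn (f ⊓ a2 ⊃ b2)%F.
    apply: (imp_trans thd); first exact: imp_weak thn _ _ mon.
    apply: (imp_trans thd (imp_refl thn _)).
    exact: imp_weak thn _ _ (or_impr thn _ _).
- move=> _ [a [b [aT bT ->]]] ab; apply: bT.
  exact: (dia_and_box thf ab ff aT).
have thT' : theory T' := pT'.
have cut a b : T (◇ f ⊃ □ a)%F -> ~ T (◇ f ⊃ ◇ b)%F -> ~ T' (f ⊓ a ⊃ b)%F.
  by move=> aT bT; apply: DT'; exists a, b.
have hi_box a : T (◇ f ⊃ □ a)%F -> forall b, ~ T (◇ f ⊃ ◇ b)%F -> ~ T' (a ⊃ b)%F.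
  move=> aT b bT ab; apply: (cut a b) => //; apply: imp_trans ab => //.
  exact: and_impr.
exists T', (fun a => forall b, ~ T (◇ f ⊃ ◇ b)%F -> ~ T' (a ⊃ b)%F),
  (fun b => ~ T (◇ f ⊃ ◇ b)%F); split=> //; last first.
  move=> b bT fb; apply: (cut ftop b) => //; apply: imp_trans fb => //.
  exact: and_impl.
split=> //.
- exact: hi_box.
- by move=> a b; apply.
(* The contradictions mirror the □ case: here b ⊃ a is [hi] but below the [lw] formula b; in the
   next clause a ⊃ b is [lw] but belongs to [T']. *)
- move=> a b bT ba; apply: contrapT => nba.
  apply: (hi_box (b ⊃ a)%F _ b) => //.
    by apply: imp_weak => //; exact: dia_box_imp.
  apply: imp_trans (prime_imp_imp pT' nba) _ => //.
  exact: prime_not_imp nba.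
- move=> a b bT ab; apply: contrapT => /not_box_dia_imp nab.
  apply: (hi_box _ boxtop (a ⊃ b)%F); last exact: imp_weak.
  by move=> h; apply: bT; exact: imp_trans h nab.
Qed.

End CutSuccessor.

(** * Subformulas *)

Fixpoint subfmls (a : fml) : seq fml :=
  a :: match a with
  | Var _ => [::]
  | Neg b | Tri b | Box b | Dia b => subfmls b
  | And b c | Or b c | Imp b c => subfmls b ++ subfmls c
  end.

Definition args (a : fml) : seq fml :=
  match a with
  | Var _ => [::]
  | Neg b | Tri b | Box b | Dia b => [:: b]
  | And b c | Or b c | Imp b c => [:: b; c]
  end.

Lemma subfmls_refl a : a \in subfmls a.
Proof. by case: a => *; rewrite inE eqxx. Qed.

Lemma args_subfmls a b : b \in args a -> b \in subfmls a.
Proof.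
case: a => [n|a|a|a c|a c|a c|a|a] //=; rewrite !in_cons ?in_nil ?orbF ?mem_cat //.
all: first [move=> /eqP -> | move=> /orP[]/eqP ->].
all: by rewrite subfmls_refl ?orbT.
Qed.

Lemma subfmls_args d a b : a \in subfmls d -> b \in args a -> b \in subfmls d.
Proof.
move=> ad ba; elim: d ad => [n|d IH|d IH|c IHc d IHd|c IHc d IHd|c IHc d IHd|d IH|d IH];
  rewrite [subfmls _]/= in_cons => /predU1P[e|{}ad];
  try (by move: ba; rewrite e; exact: args_subfmls); rewrite in_cons.
- by [].
all: try by rewrite IH ?orbT.
all: by move: ad; rewrite !mem_cat => /orP[/IHc ->|/IHd ->]; rewrite ?orbT.
Qed.

(** * The canonical model and its truth lemma *)

Section Canonical.
Variables (R : realType) (F : seq fml).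
Hypothesis F_args : forall a b, a \in F -> b \in args a -> b \in F.
Hypotheses (topF : ftop \in F) (botF : fbot \in F).
Implicit Types (T : fml -> Prop) (v : fml -> R).

Let boxF a : (□ a)%F \in F -> a \in F.
Proof. by move=> h; apply: F_args h _; rewrite inE. Qed.
Let diaF a : (◇ a)%F \in F -> a \in F.
Proof. by move=> h; apply: F_args h _; rewrite inE. Qed.

(** Access to degree d constrains v' only below d: lower bounds are therefore cut at d, and v (◇a)
    is an upper bound only when it is less than d. By the gap hypothesis a bound v (□a) below d is
    already below d', hence below what [lw] allows. *)
Lemma successor_valuation T v T' hi lw lwd (d' d : R) :
  prime_theory T -> represents T F v ->
  prime_theory T' -> cut_successor T T' hi lw lwd ->
  0 < d' -> d' < d -> d < 1 ->
  {in F, forall a, v a < d -> v a < d'} ->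
  (forall a, (□ a)%F \in F -> d <= v (□ a)%F -> hi a) ->
  (forall a, (◇ a)%F \in F -> v (◇ a)%F < d -> lwd a) ->
  exists v', [/\ represents T' F v',
    {in F, forall a, hi a -> d <= v' a},
    {in F, forall a, lw a -> v' a <= d'},
    forall a, (□ a)%F \in F -> Num.min d (v (□ a)%F) <= v' a &
    forall a, (◇ a)%F \in F -> Num.min d (v' a) <= v (◇ a)%F].
Proof.
move=> pT vT pT' cut d'0 d'd d1 gap hi_box lwd_dia.
have thT : theory T := pT; have thT' : theory T' := pT'.
have d0 : 0 < d := lt_trans d'0 d'd.
have v0 a : 0 <= v a by case/andP: (rep_itv vT a).
have v1 a : v a <= 1 by case/andP: (rep_itv vT a).
pose lo a : R := if a == ftop then 1 else if `[< hi a >] then d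
  else if (□ a)%F \in F then v (□ a)%F else 0.
pose up a : R := if a == fbot then 0
  else if ((◇ a)%F \in F) && (v (◇ a)%F < d) then v (◇ a)%F
  else if `[< lw a >] then d' else 1.
have top_nlw b : lw b -> ~ T' (ftop ⊃ b)%F.
  exact: cut_lt cut _ _ (cut_top cut).
have up_lw b : lw b -> forall a, hi a -> ~ T' (a ⊃ b)%F.
  by move=> lwb a hia; exact: cut_lt cut _ _ hia lwb.
have bot_lw := cut_lwd cut (cut_bot cut).
have lo01 a : 0 <= lo a <= 1.
  rewrite /lo; case: eqP => _; first by rewrite ler01 lexx.
  case: asboolP => _; first by rewrite !ltW.
  by case: ifP => _; rewrite ?v0 ?v1 ?lexx ?ler01.
have up01 a : 0 <= up a <= 1.
  rewrite /up; case: eqP => _; first by rewrite ler01 lexx.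
  case: ifP => _; first by rewrite v0 v1.
  by case: asboolP => _; rewrite ?ler01 ?lexx// !ltW// (lt_trans d'd).
have [||||v' vT' bounds] := @representation_between R T' F lo up pT' topF botF lo01 up01.
- by rewrite /lo eqxx.
- by rewrite /up eqxx.
- move=> a b aF bF ab.
  (* If b is not [lw], it is neither [fbot] nor bounded through ◇, so [up b] is 1. *)
  have [lwb|nlwb] := pselect (lw b); last first.
    have -> : up b = 1; last by case/andP: (lo01 a).
    rewrite /up; case: eqP => [b0|_]; first by rewrite b0 in nlwb.
    case: ifP => [/andP[bF' bd]|_]; last by case: asboolP.
    by case: nlwb; apply: cut_lwd cut _ _; exact: lwd_dia.
  have nhi : ~ hi a by move=> /(up_lw _ lwb).
  rewrite /lo; case: eqP => [atop|_]; first by rewrite atop in ab; case: (top_nlw _ lwb).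
  case: asboolP => // _; case: ifP => [aF'|_]; last by case/andP: (up01 b).
  have ad : v (□ a)%F < d by rewrite ltNge; apply/negP => /(hi_box _ aF').
  rewrite /up; case: eqP => [b0|_].
    rewrite -(rep_bot vT); apply/(rep_le vT) => //.
    apply: (imp_trans thT) (dia_bot_imp thT _).
    by apply: (cut_box_dia cut) (cut_bot cut) _; rewrite -b0.
  case: ifP => [/andP[bF' bd]|_].
    apply/(rep_le vT) => //; apply: (cut_box_dia cut) => //; exact: lwd_dia.
  by case: asboolP => // _; apply/ltW/gap.
- move=> a b aF bF nba.
  have ab := prime_not_imp pT' nba.
  have na : a != ftop.
    by apply/eqP => a1; apply: nba; rewrite a1; apply: imp_weak => //; exact: top_intro.
  have nb : b != fbot by apply/eqP => b0; apply: nba; rewrite b0; exact: bot_imp.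
  rewrite /lo /up (negbTE na) (negbTE nb).
  have [lwb|nlwb] := pselect (lw b); last first.
    have -> : ((◇ b)%F \in F) && (v (◇ b)%F < d) = false.
      apply/negP => /andP[bF' bd].
      by case: nlwb; apply: cut_lwd cut _ _; exact: lwd_dia.
    rewrite (asboolF nlwb); case: asboolP => // nhi; case: ifP => // aF'.
    by apply: lt_trans d1; rewrite ltNge; apply/negP => /(hi_box _ aF').
  have nhi : ~ hi a by move=> /(up_lw _ lwb).
  rewrite (asboolF nhi) (asboolT lwb).
  case: (boolP (_ && _)) => [/andP[bF' bd]|_].
    have lwdb := lwd_dia _ bF' bd.
    case: ifP => [aF'|_].
      by apply/(rep_lt vT) => // /(cut_dia_box cut lwdb).
    (* Here [lo a] is 0. Were v (◇b) also 0, ◇b would imply □a in [T], giving b ⊃ a in [T']. *)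
    rewrite -(rep_bot vT); apply/(rep_lt vT) => // h; apply: nba.
    by apply: (cut_dia_box cut lwdb); apply: imp_trans h _ => //; exact: bot_imp.
  case: ifP => // aF'; apply: gap => //.
  by rewrite ltNge; apply/negP => /(hi_box _ aF').
exists v'; split=> //.
- move=> a aF hia; have /andP[h _] := bounds _ aF; apply: le_trans h.
  by rewrite /lo (asboolT hia); case: ifP => // _; exact: ltW.
- move=> a aF lwa; have /andP[_ h] := bounds _ aF; apply: le_trans h _.
  rewrite /up (asboolT lwa); case: ifP => // _; first exact: ltW.
  by case: ifP => // /andP[aF' ad]; apply/ltW/gap.
- move=> a aF'; have /andP[h _] := bounds _ (boxF aF'); apply: le_trans h.
  rewrite /lo; case: eqP => _; first by rewrite ge_min v1 orbT.
  by case: asboolP => _; rewrite ge_min ?lexx// aF' lexx orbT.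
- move=> a aF'; rewrite ge_min; have [//|ad] := leP d (v (◇ a)%F).
  apply/orP; right; have /andP[_ h] := bounds _ (diaF aF'); apply: le_trans h _.
  by rewrite /up aF' ad; case: ifP.
Qed.

Record cworld := CWorld {
  cw_theory : fml -> Prop;
  cw_val : fml -> R;
  cw_prime : prime_theory cw_theory;
  cw_rep : represents cw_theory F cw_val
}.

(** By residuation, each term is the largest degree respecting the constraints from □a and ◇a; a
    modal formula outside [F] contributes the neutral 1. *)
Definition cacc (w w' : cworld) : R :=
  \big[Num.min/1]_(a <- F) Num.min
    (if (□ a)%F \in F then gimp (cw_val w (□ a)%F) (cw_val w' a) else 1)
    (if (◇ a)%F \in F then gimp (cw_val w' a) (cw_val w (◇ a)%F) else 1).

Lemma le_cacc w w' t : t <= 1 -> t <= cacc w w' <->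
  (forall a, (□ a)%F \in F -> Num.min t (cw_val w (□ a)%F) <= cw_val w' a) /\
  (forall a, (◇ a)%F \in F -> Num.min t (cw_val w' a) <= cw_val w (◇ a)%F).
Proof.
move=> t1; split=> [ta|[hb hd]].
  have h a : a \in F -> t <= Num.min
    (if (□ a)%F \in F then gimp (cw_val w (□ a)%F) (cw_val w' a) else 1)
    (if (◇ a)%F \in F then gimp (cw_val w' a) (cw_val w (◇ a)%F) else 1).
    by move=> aF; apply: le_trans ta _; exact: ge_bigmin_seq.
  split=> a aF; [have := h a (boxF aF) | have := h a (diaF aF)];
    by rewrite aF le_min => /andP[]; rewrite !le_gimp.
apply: le_bigmin => // a _; rewrite le_min; apply/andP; split; case: ifP => // aF;
  by rewrite le_gimp//; first [exact: hb | exact: hd].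
Qed.

Lemma cval_itv w a : 0 <= cw_val w a <= 1.
Proof. exact: rep_itv (cw_rep w) a. Qed.

Lemma cacc_itv w w' : 0 <= cacc w w' <= 1.
Proof.
rewrite bigmin_le_id andbT; apply/le_cacc => //.
by split=> a _; rewrite ge_min; apply/orP; left; case/andP: (cval_itv w' a) => // _;
  case/andP: (cval_itv w (◇ a)%F).
Qed.

Lemma cworld_successor w T' hi lw lwd (d' d : R) :
  prime_theory T' -> cut_successor (cw_theory w) T' hi lw lwd ->
  0 < d' -> d' < d -> d < 1 ->
  {in F, forall a, cw_val w a < d -> cw_val w a < d'} ->
  (forall a, (□ a)%F \in F -> d <= cw_val w (□ a)%F -> hi a) ->
  (forall a, (◇ a)%F \in F -> cw_val w (◇ a)%F < d -> lwd a) ->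
  exists w', [/\ d <= cacc w w', {in F, forall a, hi a -> d <= cw_val w' a} &
    {in F, forall a, lw a -> cw_val w' a <= d'}].
Proof.
move=> pT' cut d'0 d'd d1 gap hib lwd_dia.
have [v' [vT' hiv lwv boxv diav]] :=
  successor_valuation (cw_prime w) (cw_rep w) pT' cut d'0 d'd d1 gap hib lwd_dia.
exists (CWorld pT' vT'); split=> //.
by apply/le_cacc => //; exact: ltW.
Qed.

(** The threshold is taken between □f and y. As f is [lw], its value is at most d', below the degree
    of access, so the implication takes the value of f, which is less than y. *)
Lemma box_witness w f y : (□ f)%F \in F -> cw_val w (□ f)%F < y -> y <= 1 ->
  exists w', gimp (cacc w w') (cw_val w' f) < y.
Proof.
move=> fF fy y1; have pT := cw_prime w; have vT := cw_rep w.
have nf : ~ cw_theory w (□ f)%F.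
  by move=> /(rep_eq1 pT vT topF fF) f1; move: fy; rewrite f1 ltNge y1.
have [T' [hi [lw [pT' cut lwf hib]]]] := cut_successor_box pT nf.
have [d' [d [fd' d'd dy gap]]] := gap_above F (cw_val w) fy.
have /andP[f0 _] := cval_itv w (□ f)%F.
have [||||||w' [dacc _ lwv]] := cworld_successor pT' cut (d' := d') (d := d).
- exact: le_lt_trans fd'.
- by [].
- exact: lt_le_trans y1.
- by move=> a aF /(gap a aF) /le_lt_trans; exact.
- move=> a aF da; apply: hib; apply/(rep_lt vT fF aF).
  exact: lt_le_trans (lt_trans fd' d'd) da.
- move=> a aF ad; apply/(rep_le vT aF fF); exact: gap.
have wd' := lwv f (boxF fF) lwf.
exists w'; rewrite /gimp leNgt (le_lt_trans wd' (lt_le_trans d'd dacc)) /=.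
exact: le_lt_trans wd' (lt_trans d'd dy).
Qed.

(** The threshold is taken between y and ◇f; both the degree of access and the value of the [hi]
    formula f reach d. *)
Lemma dia_witness w f y : (◇ f)%F \in F -> 0 <= y -> y < cw_val w (◇ f)%F ->
  exists w', y < gand (cacc w w') (cw_val w' f).
Proof.
move=> fF y0 yf; have pT := cw_prime w; have vT := cw_rep w.
have nf : ~ cw_theory w (◇ f ⊃ fbot)%F.
  by move=> /(rep_eq0 vT botF fF) f0; move: yf; rewrite f0 ltNge y0.
have [T' [hi [lw [pT' cut hif hib]]]] := cut_successor_dia pT nf.
have [d' [d [yd' d'd df gap]]] := gap_below F (cw_val w) yf.
have /andP[_ f1] := cval_itv w (◇ f)%F.
have [||||||w' [dacc hiv _]] := cworld_successor pT' cut (d' := d') (d := d).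
- exact: le_lt_trans yd'.
- by [].
- exact: lt_le_trans f1.
- by move=> a aF ad; apply: gap => //; exact: lt_trans df.
- move=> a aF da; apply: hib; apply/(rep_le vT fF aF); rewrite leNgt.
  by apply/negP => /(gap _ aF) ad'; move: da; rewrite leNgt (lt_trans ad' d'd).
- by move=> a aF ad; apply/(rep_lt vT aF fF); exact: lt_trans df.
exists w'; apply: (lt_le_trans (lt_trans yd' d'd)).
by rewrite /gand le_min dacc (hiv f (diaF fF) hif).
Qed.

Section Model.
Variable w0 : cworld.

Definition cmodel : model R :=
  @Model R (@FuzzyFrame R cworld (inhabits w0) cacc cacc_itv)
    (fun n w => cw_val w (Var n)) (fun n w => cval_itv w (Var n)).

Lemma eval_cmodel a (w : cworld) : a \in F -> @eval R cmodel a w = cw_val w a.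
Proof.
elim: a w => [n|a IHa|a IHa|a IHa b IHb|a IHa b IHb|a IHa b IHb|a IHa|a IHa] w aF.
- by [].
- have aF' : a \in F by apply: F_args aF _; rewrite mem_head.
  by rewrite (rep_neg (cw_prime w) (cw_rep w))//= IHa.
- have aF' : a \in F by apply: F_args aF _; rewrite mem_head.
  by rewrite (rep_tri (cw_prime w) (cw_rep w))//= IHa.
- have aF' : a \in F by apply: F_args aF _; rewrite mem_head.
  have bF' : b \in F by apply: F_args aF _; rewrite !in_cons eqxx orbT.
  by rewrite (rep_and (cw_prime w) (cw_rep w))//= IHa// IHb.
- have aF' : a \in F by apply: F_args aF _; rewrite mem_head.
  have bF' : b \in F by apply: F_args aF _; rewrite !in_cons eqxx orbT.
  by rewrite (rep_or (cw_prime w) (cw_rep w))//= IHa// IHb.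
- have aF' : a \in F by apply: F_args aF _; rewrite mem_head.
  have bF' : b \in F by apply: F_args aF _; rewrite !in_cons eqxx orbT.
  by rewrite (rep_imp (cw_prime w) (cw_rep w))//= IHa// IHb.
- have /andP[_ v1] := cval_itv w (□ a)%F.
  apply/eqP; rewrite eq_le; apply/andP; split; last first.
    apply/(@le_eval_box R cmodel) => // w'; rewrite IHa; last exact: boxF.
    have /andP[_ r1] := cacc_itv w w'.
    by have [/(_ _ aF) + _] := (le_cacc w w' r1).1 (lexx _); rewrite minC.
  (* With y the value of □a in the model, the witness would have an implication strictly below the
     infimum y. *)
  rewrite leNgt; apply/negP => ay.
  have [|w' wy] := box_witness aF ay; first exact: (@eval_le1 R cmodel).
  have := ((@le_eval_box R cmodel a w _ (@eval_le1 R cmodel _ _)).1 (lexx _)) w'.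
  rewrite IHa; last exact: boxF.
  by rewrite -le_gimp ?(@eval_le1 R cmodel)// leNgt wy.
- have /andP[v0 _] := cval_itv w (◇ a)%F.
  apply/eqP; rewrite eq_le; apply/andP; split.
    apply/(@eval_dia_le R cmodel) => w'; rewrite IHa; last exact: diaF.
    have /andP[_ r1] := cacc_itv w w'.
    by have [_ /(_ _ aF)] := (le_cacc w w' r1).1 (lexx _).
  rewrite leNgt; apply/negP => ya.
  have [|w' wy] := dia_witness aF _ ya; first exact: (@eval_ge0 R cmodel).
  have := ((@eval_dia_le R cmodel a w _).1 (lexx _)) w'.
  rewrite IHa; last exact: diaF.
  by rewrite leNgt -/(gand _ _) wy.
Qed.

End Model.
End Canonical.

(** * Completeness for finite sets of assumptions *)

Lemma eval_bigand (R : realType) (M : model R) (w : M) s a :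
  a \in s -> eval (foldr And ftop s) w <= eval a w.
Proof.
elim: s => // b s IH; rewrite in_cons [X in X <= _]/= ge_min.
by move=> /predU1P[->|/IH ->]; rewrite ?lexx ?orbT.
Qed.

Lemma derives_bigand G s :
  {in s, forall a, G a} -> derives G (foldr And ftop s).
Proof.
have thG := theory_derives G.
elim: s => [_|a s IH sG] /=; first exact: top_intro.
apply: and_intro => //; first by apply/d_hyp/sG; rewrite mem_head.
by apply: IH => b bs; apply: sG; rewrite in_cons bs orbT.
Qed.

Lemma completeness (R : realType) (G : set fml) (c : fml) :
  finite_set G -> entails R G c -> derives G c.
Proof.
move=> /finite_seqP[s ->] sc; set p := foldr And ftop s.
have [pc|npc] := pselect (derives set0 (p ⊃ c)%F).
  by apply: d_mp (derives_weaken _ pc) _; exact: derives_bigand.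
have [||T [pT npcT]] := @prime_extension (fun x => x = (p ⊃ c)%F) (p ⊃ c)%F erefl.
- move=> _ _ -> ->; exists (p ⊃ c)%F; split=> //; exact: imp_refl theory_nil _.
- by move=> _ ->.
(* Appending [fbot] brings [fbot] and its argument [ftop] into [F]. *)
pose F := subfmls ((p ⊃ c) ⊃ fbot)%F.
have F_args a b : a \in F -> b \in args a -> b \in F by exact: subfmls_args.
have F0 : ((p ⊃ c) ⊃ fbot)%F \in F by exact: subfmls_refl.
have botF : fbot \in F by apply: F_args F0 _; rewrite !in_cons eqxx orbT.
have topF : ftop \in F by apply: F_args botF _; rewrite mem_head.
have pcF : (p ⊃ c)%F \in F by apply: F_args F0 _; rewrite mem_head.
have pF : p \in F by apply: F_args pcF _; rewrite mem_head.
have cF : c \in F by apply: F_args pcF _; rewrite !in_cons eqxx orbT.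
have [v vT] := representation_exists R pT topF botF.
pose w := CWorld pT vT; pose M := cmodel F_args w.
(* This refutes the entailment at [w], since by the truth lemma every assumption has there at least
   the value of p. *)
have : v c < v p by apply/(rep_lt vT) => //; exact: npcT.
rewrite ltNge => /negP; case.
rewrite -[v c]/(cw_val w c) -[v p]/(cw_val w p).
rewrite -!(eval_cmodel F_args topF botF w)//.
apply: le_trans (sc M w); apply/le_inf_hyps; split; first exact: eval_le1.
by move=> a /= as_; exact: eval_bigand.
Qed.

Theorem theorem3p10 (R : realType) (G : set fml) (c : fml)
  (finG : finite_set G) :
  entails R G c <-> derives G c.
Proof. by split; [exact: completeness | exact: soundness]. Qed.
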